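(* Let $N\ge1$ be an integer and let $0<t_1<t_2<\dots<t_N$ be real numbers. Put $S(t_1,\dots,t_N):=\{(-1)^kt_k\}_{k=1}^N$. Then both sets $S(t_1,\dots,t_N)$ and $-S(t_1,\dots,t_N)$ are uniqueness sets for every space $P(M)$ with $M\subset\mathbb{N}_0$, $\#M=N$.
   Context: $\mathbb{N}_0=\{0,1,2,\dots\}$ and $\#M$ is the number of elements of $M$. For a finite set $M\subset\mathbb{N}_0$, $P(M)$ is the set of real polynomials with exponents in $M$: $$P(M):=\Big\{P(x)=\sum_{m\in M}c_mx^{m}: c_m\in\mathbb{R}\Big\}.$$ A set $X\subset\mathbb{R}$ is a uniqueness set for $P(M)$ if the only $P\in P(M)$ vanishing at every point of $X$ is $P\equiv0$. Also $-S:=\{-s:s\in S\}$. *)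

(* Defs.v *)
From mathcomp Require Import all_boot all_order all_algebra.
From mathcomp Require Import finmap.
From mathcomp Require Import classical_sets reals.

Set Implicit Arguments.
Unset Strict Implicit.
Unset Printing Implicit Defensive.

Import Order.TTheory GRing.Theory Num.Theory.

Local Open Scope classical_set_scope.
Local Open Scope ring_scope.

Definition polys_with_exponents (R : realType) (M : {fset nat}) :
    set {poly R} :=
  [set p | exists c : nat -> R, p = \sum_(m <- M) c m *: 'X^m].

(* R is infinite, so p = 0 in {poly R} is the same as p vanishing identically. *)
Definition uniqueness_set (R : realType) (P : set {poly R}) (X : set R) :
    Prop :=
  forall p, P p -> (forall x, X x -> p.[x] = 0) -> p = 0.

(* The index i : 'I_N is 0-based: t i is t_(i+1), hence the sign (-1)^(i+1). *)
Definition alternating_set (R : realType) (N : nat) (t : 'I_N -> R) : set R :=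
  [set (-1) ^+ i.+1 * t i | i in [set: 'I_N]].

Definition opp_set (R : realType) (S : set R) : set R := [set - s | s in S].

(* Main.v *)
Require Import Defs.
From mathcomp Require Import all_boot all_order all_algebra.
From mathcomp Require Import finmap.
From mathcomp Require Import classical_sets reals.
From mathcomp Require Import polyrcf.

Import Order.TTheory GRing.Theory Num.Theory.

Local Open Scope classical_set_scope.
Local Open Scope ring_scope.

(** Write [p = E + O] with [E] the even and [O] the odd part of [p], so that
    [p] vanishes at [(-1)^k t_k] exactly when [E(t_k) = - (-1)^k O(t_k)].  Then
    [E(t_k) E(t_(k+1)) = - O(t_k) O(t_(k+1))] for consecutive nodes, so for
    each of the [N - 1] gaps, by the intermediate value theorem, [E] has a root
    [x] with [t_k <= x < t_(k+1)] or [O] has one with [t_k < x <= t_(k+1)]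
    ([root_in_gap]).  These half-open intervals are disjoint, whence
    the numbers of distinct positive roots of [E] and of [O] add up to at least
    [N - 1].

    On the other hand, a nonzero polynomial with at most [n] monomials has at
    most [n - 1] distinct positive roots ([lt_size_pos_roots], the weak form of
    Descartes' rule of signs).  If [a] exponents of [M] are even and [b] are
    odd, with [a + b = N], then [E] and [O] cannot both be nonzero, since these
    numbers would then add up to at most [(a - 1) + (b - 1) = N - 2].
    If [E] or [O] is zero, the other vanishes at all [t_k] and is zero by the same bound. *)

Lemma rolle_path (R : rcfType) (p : {poly R}) (x : R) (s : seq R) :
  path <%R x s -> all (root p) (x :: s) ->
  exists s', [/\ size s' = size s, path <%R x s' & all (root p^`()) s'].
Proof.
elim: s x => [|y s IHs] x /=; first by exists [::].
case/andP=> xy ys /and3P[px py ps].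
have [s' [sz_s' ys' ps']] : exists s',
    [/\ size s' = size s, path <%R y s' & all (root p^`()) s'].
  by apply: IHs => //=; rewrite py.
have [|c] := @poly_rolle R x y p xy; first by rewrite (eqP px) (eqP py).
rewrite in_itv /= => /andP[xc cy] p'c; exists (c :: s'); split=> /=.
- by rewrite sz_s'.
- rewrite xc /=; case: s' ys' {sz_s' ps'} => //= z s' /andP[yz ->].
  by rewrite (lt_trans cy yz).
- by rewrite ps' andbT; apply/eqP.
Qed.

(** The list [M] may contain exponents that do not occur in [p].  Induction on [size M]: a power of ['X] is divided out to
    make the constant coefficient nonzero, and the derivative then has one
    monomial less and, by Rolle's theorem, at most one positive root less. *)
Lemma lt_size_sorted_pos_roots (R : rcfType) (p : {poly R}) (M : seq nat)
    (s : seq R) :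
  p != 0 -> (forall i, p`_i != 0 -> i \in M) ->
  path <%R 0 s -> all (root p) s -> (size s < size M)%N.
Proof.
move: {2}(size M) (erefl (size M)) => n.
elim: n p M s => [|n IHn] p M s szM p0 pM s_gt0 ps.
  move/size0nil: szM pM => -> pM; case/eqP: p0.
  by apply/polyP=> i; rewrite coef0; apply/eqP; apply: contraT => /pM.
have [k [q]] := multiplicity_XsubC p 0; rewrite p0 subr0 /= => q0 def_p.
have coef_q i : q`_i = p`_(i + k).
  by rewrite def_p coefMXn ltnNge leq_addl addnK.
have kM : k \in M by apply: pM; rewrite -[k]add0n -coef_q -horner_coef0.
have qs : all (root q) s.
  apply/allP=> x xs; have x_gt0 : 0 < x.
    by move: s_gt0; rewrite lt_path_sortedE => /andP[/allP/(_ x xs)].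
  move/allP/(_ x xs): ps.
  by rewrite def_p rootM /root hornerXn expf_eq0 (gt_eqF x_gt0) andbF orbF.
case: s s_gt0 ps qs => [|x s]; first by rewrite szM.
move=> /= /andP[x_gt0 xs] _ qxs.
have [s' [<- xs' qs']] := @rolle_path _ _ _ _ xs qxs.
(* The exponents of the derivative of q are among those of this list. *)
have M'E : size [seq (i - k).-1 | i <- rem k M] = n.
  by rewrite size_map size_rem // szM.
rewrite szM ltnS -[X in (_ < X)%N]M'E.
apply: (IHn q^`()) => //.
- case/andP: qxs => /eqP qx0 _; apply: contra q0 => /eqP q'0.
  suff def_q : q = (q`_0)%:P by move: qx0; rewrite def_q !rootE !hornerC => ->.
  apply/polyP=> -[|i]; rewrite coefC //=; apply/eqP.
  by have /eqP := coef_deriv q i; rewrite q'0 coef0 eq_sym mulrn_eq0.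
- move=> i; rewrite coef_deriv mulrn_eq0 /= coef_q => /pM iM.
  apply/mapP; exists (i.+1 + k)%N; last by rewrite addnK.
  have : (i.+1 + k)%N \in k :: rem k M by rewrite -(perm_mem (perm_to_rem kM)).
  by rewrite inE -[X in _ == X]add0n eqn_add2r.
- by case: s' xs' {qs'} => //= y s' /andP[xy ->]; rewrite (lt_trans x_gt0 xy).
Qed.

Lemma lt_size_pos_roots (R : rcfType) (p : {poly R}) (M : seq nat)
    (s : seq R) :
  p != 0 -> (forall i, p`_i != 0 -> i \in M) ->
  uniq s -> {in s, forall x, 0 < x} -> {in s, forall x, root p x} ->
  (size s < size M)%N.
Proof.
move=> p0 pM s_uniq s_gt0 ps; rewrite -(size_sort <=%R).
apply: (lt_size_sorted_pos_roots _ p) => //.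
  rewrite lt_path_sortedE sort_lt_sorted s_uniq andbT.
  by apply/allP=> x; rewrite mem_sort => /s_gt0.
by apply/allP=> x; rewrite mem_sort => /ps.
Qed.

Lemma horner_signr_even (R : comNzRingType) (M : seq nat) (c : nat -> R)
    (x : R) (k : nat) :
  (\sum_(m <- M | ~~ odd m) c m *: 'X^m).[(-1) ^+ k * x] =
  (\sum_(m <- M | ~~ odd m) c m *: 'X^m).[x].
Proof.
rewrite !horner_sum; apply: eq_bigr => m /negPf m_even.
by rewrite !hornerE exprMn -exprM mulnC exprM -signr_odd m_even expr1n mul1r.
Qed.

Lemma horner_signr_odd (R : comNzRingType) (M : seq nat) (c : nat -> R)
    (x : R) (k : nat) :
  (\sum_(m <- M | odd m) c m *: 'X^m).[(-1) ^+ k * x] =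
  (-1) ^+ k * (\sum_(m <- M | odd m) c m *: 'X^m).[x].
Proof.
rewrite !horner_sum mulr_sumr; apply: eq_bigr => m m_odd.
rewrite !hornerZ !hornerXn exprMn -exprM mulnC exprM -(signr_odd _ m) m_odd.
by rewrite expr1 mulrCA.
Qed.

Lemma coef_sum_monomials (R : nzRingType) (M : seq nat) (P : pred nat)
    (c : nat -> R) (i : nat) :
  (\sum_(m <- M | P m) c m *: 'X^m)`_i != 0 -> i \in [seq m <- M | P m].
Proof.
apply: contraNT => iM; rewrite -big_filter coef_sum big_seq big1 // => m mM.
by rewrite coefZ coefXn; case: eqP mM iM => [-> ->|]; rewrite ?mulr0.
Qed.

(** The hypotheses hold for the even and odd parts of a polynomial vanishing at
    [e * u] and [- e * v].  The boolean tells which of [E] and [O] has the root.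
    Half-open intervals keep the roots found in consecutive gaps distinct. *)
Lemma root_in_gap (R : rcfType) (E O : {poly R}) (u v e : R) :
  u < v -> e ^+ 2 = 1 ->
  E.[u] + e * O.[u] = 0 -> E.[v] - e * O.[v] = 0 ->
  exists br : bool * R, if br.1 then root E br.2 && (u <= br.2 < v)
                        else root O br.2 && (u < br.2 <= v).
Proof.
move=> uv e2 Hu Hv.
have [Eu0|Eu0] := eqVneq E.[u] 0.
  by exists (true, u) => /=; rewrite /root Eu0 eqxx lexx.
have [Ov0|Ov0] := eqVneq O.[v] 0.
  by exists (false, v) => /=; rewrite /root Ov0 eqxx lexx uv.
have e0 : e != 0.
  by apply: contra_eq_neq e2 => ->; rewrite expr0n eq_sym oner_eq0.
have EuE : E.[u] = - (e * O.[u]) by apply/eqP; rewrite -addr_eq0 Hu.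
have EvE : E.[v] = e * O.[v] by apply/eqP; rewrite -subr_eq0 Hv.
have EO : E.[u] * E.[v] = - (O.[u] * O.[v]).
  by rewrite EuE EvE mulNr mulrACA -expr2 e2 mul1r.
have [EE|EE|/eqP] := ltgtP (E.[u] * E.[v]) 0.
- have [x] := poly_ivtoo (ltW uv) EE; rewrite in_itv /= => /andP[ux xv] Ex.
  by exists (true, x); rewrite /= Ex (ltW ux).
- have OO : O.[u] * O.[v] < 0 by rewrite -oppr_gt0 -EO.
  have [x] := poly_ivtoo (ltW uv) OO; rewrite in_itv /= => /andP[ux xv] Ox.
  by exists (false, x); rewrite /= Ox ux (ltW xv).
- by rewrite mulf_eq0 (negPf Eu0) EvE mulf_eq0 (negPf e0) (negPf Ov0).
Qed.

(** The exponent [b] fixes the sign at the first node, so that alternating nodes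
    starting on either side of [0] are covered. *)
Lemma sparse_alternating_eq0 (R : rcfType) (n : nat) (t : 'I_n.+1 -> R)
    (M : seq nat) (c : nat -> R) (b : nat) :
  (forall i, 0 < t i) -> (forall i j : 'I_n.+1, (i < j)%N -> t i < t j) ->
  size M = n.+1 ->
  (forall i : 'I_n.+1,
     (\sum_(m <- M) c m *: 'X^m).[(-1) ^+ (i + b) * t i] = 0) ->
  \sum_(m <- M) c m *: 'X^m = 0.
Proof.
move=> t_gt0 t_incr szM.
rewrite (bigID odd) /= addrC.
set E := \sum_(m <- M | ~~ odd m) _; set O := \sum_(m <- M | odd m) _ => root_p.
have pE (i : 'I_n.+1) : E.[t i] + (-1) ^+ (i + b) * O.[t i] = 0.
  by rewrite -(root_p i) hornerD horner_signr_even horner_signr_odd.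
have szEO : (size [seq m <- M | ~~ odd m] + size [seq m <- M | odd m])%N = n.+1.
  by rewrite !size_filter addnC count_predC.
have t_le (i j : 'I_n.+1) : (i <= j)%N -> t i <= t j.
  by rewrite leq_eqVlt => /orP[/eqP/val_inj ->|/t_incr/ltW].
have t_inj : injective t.
  by move=> i j tij; apply: val_inj; case: (ltngtP i j) => // /t_incr;
    rewrite tij ltxx.
(* Vanishing at all n + 1 nodes would force at least n + 2 monomials. *)
have nodes_eq0 (P : pred nat) :
    (forall i, (\sum_(m <- M | P m) c m *: 'X^m).[t i] = 0) ->
    \sum_(m <- M | P m) c m *: 'X^m = 0.
  move=> P0; apply/eqP; apply: contraT => p0.
  have : (size (map t (enum 'I_n.+1)) < size [seq m <- M | P m])%N.
    apply: (lt_size_pos_roots _ _ _ _ p0); first exact: coef_sum_monomials.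
    - by rewrite map_inj_uniq // enum_uniq.
    - by move=> x /mapP[i _ ->].
    - by move=> x /mapP[i _ ->]; apply/eqP.
  by rewrite size_map size_enum_ord -szM size_filter ltnNge count_size.
have [E0|E0] := eqVneq E 0.
  rewrite E0 add0r; apply: nodes_eq0 => i; apply/eqP.
  by have /eqP := pE i; rewrite E0 horner0 add0r mulf_eq0 signr_eq0.
have [O0|O0] := eqVneq O 0.
  rewrite O0 addr0; apply: nodes_eq0 => i.
  by have := pE i; rewrite O0 horner0 mulr0 addr0.
pose l (i : 'I_n) : 'I_n.+1 := widen_ord (leqnSn n) i.
pose r (i : 'I_n) : 'I_n.+1 := lift ord0 i.
have rE (i : 'I_n) : r i = i.+1 :> nat by [].
(* Gap number i, between nodes l i and r i, is assigned the root (f i).2, of E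
   or of O according to (f i).1; s true and s false list these roots. *)
have [f fP] : exists f : 'I_n -> bool * R, forall i,
    if (f i).1 then root E (f i).2 && (t (l i) <= (f i).2 < t (r i))
               else root O (f i).2 && (t (l i) < (f i).2 <= t (r i)).
  apply: (@fin_all_exists _ (fun=> (bool * R)%type) (fun i br =>
    is_true (if br.1 then root E br.2 && (t (l i) <= br.2 < t (r i))
     else root O br.2 && (t (l i) < br.2 <= t (r i))))) => i.
  apply: (@root_in_gap _ _ _ _ _ ((-1) ^+ (i + b))).
  - by apply: t_incr; rewrite rE.
  - by rewrite sqrr_sign.
  - exact: (pE (l i)).
  - by rewrite -mulNr -mulN1r -exprS; apply: (pE (r i)).
pose s v := [seq (f i).2 | i <- enum 'I_n & (f i).1 == v].
have f_gt0 i : 0 < (f i).2.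
  have := fP i; case: ifP => _ /and3P[_].
    by move=> /(lt_le_trans (t_gt0 _)).
  by move=> /(lt_trans (t_gt0 _)).
have f_lt (i j : 'I_n) : (i < j)%N -> (f i).1 = (f j).1 -> (f i).2 < (f j).2.
  move=> ij fij; have tij : t (r i) <= t (l j) by apply: t_le; rewrite rE.
  have := fP i; have := fP j; rewrite fij; case: ifP => _.
    by move=> /and3P[_ lj _] /and3P[_ _ ri];
      apply: lt_le_trans ri (le_trans tij lj).
  by move=> /and3P[_ lj _] /and3P[_ _ ri];
      apply: le_lt_trans ri (le_lt_trans tij lj).
have s_uniq v : uniq (s v).
  rewrite map_inj_in_uniq; first by rewrite filter_uniq // enum_uniq.
  move=> i j; rewrite !mem_filter => /andP[/eqP fi _] /andP[/eqP fj _] fij.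
  apply: val_inj; case: (ltngtP i j) => // /f_lt;
    by rewrite fi fj fij ltxx => /(_ erefl).
have s_gt0 v : {in s v, forall x, 0 < x} by move=> x /mapP[i _ ->].
have szs : (size (s true) + size (s false))%N = n.
  rewrite !size_map !size_filter -[RHS]size_enum_ord.
  rewrite -[RHS](count_predC (fun i => (f i).1 == true)); congr addn.
  by apply: eq_count => i /=; case: (f i).1.
have sE : (size (s true) < size [seq m <- M | ~~ odd m])%N.
  apply: (lt_size_pos_roots _ E) => //; first exact: coef_sum_monomials.
  move=> x /mapP[i]; rewrite mem_filter => /andP[/eqP fi _] ->.
  by have := fP i; rewrite fi => /andP[].
have sO : (size (s false) < size [seq m <- M | odd m])%N.
  apply: (lt_size_pos_roots _ O) => //; first exact: coef_sum_monomials.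
  move=> x /mapP[i]; rewrite mem_filter => /andP[/eqP fi _] ->.
  by have := fP i; rewrite fi => /andP[].
by have := leq_add sE sO; rewrite szEO addSn addnS szs ltnn.
Qed.

Theorem theorem2 (R : realType) (N : nat) (hN : (1 <= N)%N) (t : 'I_N -> R)
    (t_gt0 : forall i : 'I_N, 0 < t i)
    (t_incr : forall i j : 'I_N, (i < j)%N -> t i < t j)
    (M : {fset nat}) (cardM : #|` M|%fset = N) :
  uniqueness_set (@polys_with_exponents R M) (alternating_set t) /\
  uniqueness_set (@polys_with_exponents R M) (opp_set (alternating_set t)).
Proof.
(* The nodes (-1)^(i+1) t_i, resp. their opposites, correspond to b = 1, 2. *)
case: N hN t t_gt0 t_incr cardM => // n _ t t_gt0 t_incr cardM.
split=> p [c ->] p0; [apply: (@sparse_alternating_eq0 _ n t _ _ 1) => // i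
                     |apply: (@sparse_alternating_eq0 _ n t _ _ 2) => // i];
  apply: p0.
  by exists i => //; rewrite addn1.
exists ((-1) ^+ i.+1 * t i); first by exists i.
by rewrite addn2 [in RHS]exprS mulN1r mulNr.
Qed.
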